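(* For every integer $N\ge 1$, $$\mathrm{Var}[\Delta Y^A_{2N}] = \mathrm{Var}[\Delta Y^S_{2N}] - \tfrac12\,\mathbb{E}\big[\mathrm{Var}[Y_N\mid X]\big],$$ or equivalently $$\mathrm{Var}[\Delta Y^S_{2N}]-\mathrm{Var}[\Delta Y^A_{2N}] = \tfrac12\,\big\|Y_N-\mathbb{E}[Y_N\mid X]\big\|_{L^2}^2=\tfrac12\,\mathbb{E}\big[\mathrm{Var}[Y_N\mid X]\big].$$ This difference is always non-negative, and it is positive whenever $F(X,U)$ is not independent from $X$.
   Context: On a probability space, $X$ is an $\mathbb{R}^d$-valued random variable with absolutely continuous law, $U$ is an $\mathbb{R}^q$-valued random variable independent of $X$, $F:\mathbb{R}^d\times\mathbb{R}^q\to\mathbb{R}$ is Borel with $F(X,U)$ square integrable, and $f:\mathbb{R}\to\mathbb{R}$ is measurable. Let $(U_n)_{n\ge1}$ be i.i.d. copies of $U$, independent of $X$. For $N\ge 1$ put $\hat E_N(X)=\frac1N\sum_{n=1}^N F(X,U_n)$ and $Y_N=f(\hat E_N(X))$, with $Y_N$ square integrable for every $N\ge1$. Define $$Y^f_{2N}=f\Big(\tfrac1{2N}\sum_{n=1}^{2N}F(X,U_n)\Big),\quad Y^c_{2N}=f\Big(\tfrac1N\sum_{n=1}^{N}F(X,U_n)\Big),\quad Y^{c'}_{2N}=f\Big(\tfrac1N\sum_{n=N+1}^{2N}F(X,U_n)\Big).$$ The standard level is $\Delta Y^S_{2N}=Y^f_{2N}-Y^c_{2N}$ and the antithetic level is $\Delta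 Y^A_{2N}=Y^f_{2N}-\frac12(Y^c_{2N}+Y^{c'}_{2N})$.
   Formalization: The clause ''positive whenever F(X,U) is not independent from X'' is false (F(x,u)=x_1, f=id gives difference 0); it is replaced by: the difference is positive if and only if Y_N is not almost surely a Borel function of X. *)

(* Defs.v *)
From HB Require Import structures.
From mathcomp Require Import all_boot all_order all_algebra.
From mathcomp Require Import all_classical all_reals all_analysis.
From mathcomp Require Import measurable_realfun.

Set Implicit Arguments.
Unset Strict Implicit.
Unset Printing Implicit Defensive.

Import Order.TTheory GRing.Theory Num.Theory.
Import numFieldNormedType.Exports.

Local Open Scope classical_set_scope.
Local Open Scope ring_scope.
Local Open Scope ereal_scope.

(* R^d is [d.-tuple R] with its product sigma-algebra, which is the Borel
   sigma-algebra of R^d. *)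

(* d-dimensional Lebesgue measure, as the iterated product of
   one-dimensional Lebesgue measure evaluated by Tonelli's formula. *)
Fixpoint lebesgue_tuple (R : realType) (d : nat) :
    set (d.-tuple R) -> \bar R :=
  match d return set (d.-tuple R) -> \bar R with
  | 0 => fun A => \d_[tuple] A
  | d'.+1 => fun A =>
      \int[lebesgue_measure]_x lebesgue_tuple [set t | A (cons_tuple x t)]
  end.
Arguments lebesgue_tuple R d A : clear implicits.

Section probability_notions.
Context (d0 : measure_display) (T : measurableType d0) (R : realType).
Variable P : probability T R.

Definition abs_continuous_law d (X : {RV P >-> d.-tuple R}) : Prop :=
  distribution P X `<< lebesgue_tuple R d.

Definition same_law d1 (E : measurableType d1) (X Y : {RV P >-> E}) : Prop :=
  forall B, measurable B -> distribution P X B = distribution P Y B.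

Definition independent_rvs d1 d2 (E1 : measurableType d1)
    (E2 : measurableType d2) (X : {RV P >-> E1}) (Y : {RV P >-> E2}) : Prop :=
  forall A B, g_sigma_algebra_preimage X A -> g_sigma_algebra_preimage Y B ->
    P (A `&` B) = P A * P B.

Definition mutually_independent (I : eqType) (G : I -> set (set T)) : Prop :=
  forall (J : seq I) (A : I -> set T), uniq J ->
    (forall i, i \in J -> G i (A i)) ->
    P (\bigcap_(i in [set` J]) A i) = \prod_(i <- J) P (A i).

(* The index [None] carries sigma(X) and [Some n] carries sigma(U_ n): mutual
   independence of this family says both that the U_ n are mutually
   independent and that X is independent of the whole sequence. *)
Definition joint_sigma d1 d2 (E1 : measurableType d1) (E2 : measurableType d2)
    (X : {RV P >-> E1}) (U_ : nat -> {RV P >-> E2}) (o : option nat) :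
    set (set T) :=
  if o is Some n then g_sigma_algebra_preimage (U_ n)
  else g_sigma_algebra_preimage X.

Section conditional.
Context d1 (E : measurableType d1) (X : {RV P >-> E}).

(* Z is a version of E[Y | X]. *)
Definition is_cond_expectation (Y Z : T -> R) : Prop :=
  [/\ forall B, measurable B -> g_sigma_algebra_preimage X (Z @^-1` B),
      Z \in Lfun P 1
    & forall A, g_sigma_algebra_preimage X A ->
        \int[P]_(w in A) (Z w)%:E = \int[P]_(w in A) (Y w)%:E].

(* A chosen version; it is one whenever Y is integrable, see
   [cond_expectationP]. *)
Definition cond_expectation (Y : T -> R) : T -> R :=
  xget (cst 0%R) [set Z | is_cond_expectation Y Z].

Definition cond_variance (Y : T -> R) : T -> R :=
  cond_expectation (fun w => (Y w - cond_expectation Y w) ^+ 2)%R.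

(* Y is almost surely a Borel function of X.  For square-integrable Y, the
   negation of this property is equivalent to E[Var[Y | X]] > 0.  When Y is
   f applied to an empirical mean of F(X, U_n), dependence of F(X, U) on X
   does not entail that negation: if f is constant, or if F(x, u) = x_1, then
   Y is a function of X. *)
Definition as_function_of (Y : T -> R) : Prop :=
  exists2 g : E -> R, measurable_fun [set: E] g &
    {ae P, forall w, Y w = g (X w)}.

Lemma cond_expectation_ex (Y : T -> R) :
  Y \in Lfun P 1 -> exists Z, is_cond_expectation Y Z.
Proof.
move=> /Lfun1_integrable intY.
have mX : measurable_fun [set: T] X by exact: measurable_funPT.
have mXA A : measurable A -> measurable (X @^-1` A).
  by move=> mA; rewrite -[_ @^-1` _]setTI; exact: mX.
pose ind : {charge set T -> \bar R} := induced_charge intY.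
pose nu0 : {charge set E -> \bar R} := pushforward ind X.
pose nu : {charge set E -> \bar R} := nu0 mX.
have numu : nu `<< distribution P X.
  apply: dominates_pushforward => //; apply/null_content_dominatesP => A mA A0.
  apply: null_set_integral => //.
  exact/measurable_funTS/(measurable_int P intY).
pose g := Radon_Nikodym nu (distribution P X).
have intg : (distribution P X).-integrable [set: E] g.
  exact: Radon_Nikodym_integrable.
have gfin x : g x \is a fin_num by exact: Radon_Nikodym_fin_num.
have mg : measurable_fun [set: E] g by exact: measurable_int intg.
have intgX : P.-integrable [set: T] (g \o X).
  apply/integrableP; split; first exact: measurableT_comp.
  have /integrableP[_] := intg.
  rewrite /distribution ge0_integral_pushforward ?preimage_setT//.
  exact: measurableT_comp.
have gXE : EFin \o (fun w => fine (g (X w))) = g \o X.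
  by apply/funext => w /=; rewrite fineK.
exists (fun w => fine (g (X w))); split.
- move=> B mB; exists ((fine \o g) @^-1` B); last by rewrite setTI.
  rewrite -[_ @^-1` _]setTI.
  suff mfg : measurable_fun [set: E] (fine \o g) by exact: mfg.
  apply/measurable_EFinP; rewrite (_ : _ \o _ = g)//.
  by apply/funext => x /=; rewrite fineK.
- by apply/Lfun1_integrable; rewrite gXE.
- move=> _ [B mB <-]; rewrite setTI.
  transitivity (\int[P]_(w in X @^-1` B) (g \o X) w).
    by apply: eq_integral => w _; rewrite -gXE.
  rewrite -integral_pushforward//; last first.
    by apply: integrableS intgX => //; exact: mXA.
  by rewrite -(Radon_Nikodym_integral numu mB).
Qed.

Lemma cond_expectationP (Y : T -> R) :
  Y \in Lfun P 1 -> is_cond_expectation Y (cond_expectation Y).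
Proof.
by move=> /cond_expectation_ex[Z ZY]; exact: (xgetPex (cst 0%R) (ex_intro _ Z ZY)).
Qed.

End conditional.

Section levels.
Context (d q : nat) (F : d.-tuple R * q.-tuple R -> R) (f : R -> R).
Context (X : {RV P >-> d.-tuple R}) (U_ : nat -> {RV P >-> q.-tuple R}).
Local Open Scope ring_scope.

(* Samples are numbered from 0, so that U_ n is the (n+1)-st copy of U and the
   samples m+1, ..., n of the one-based numbering are U_ m, ..., U_ n.-1. *)
Definition empirical_mean (m n : nat) (w : T) : R :=
  (n - m)%:R^-1 * \sum_(m <= k < n) F (X w, U_ k w).

Definition Y_ (N : nat) (w : T) : R := f (empirical_mean 0 N w).

Definition Y_fine (N : nat) (w : T) : R := f (empirical_mean 0 (2 * N) w).

Definition Y_coarse (N : nat) (w : T) : R := f (empirical_mean 0 N w).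

Definition Y_coarse' (N : nat) (w : T) : R := f (empirical_mean N (2 * N) w).

Definition standard_level (N : nat) (w : T) : R := Y_fine N w - Y_coarse N w.

Definition antithetic_level (N : nat) (w : T) : R :=
  Y_fine N w - 2^-1 * (Y_coarse N w + Y_coarse' N w).

End levels.
End probability_notions.

(* Main.v *)
(* Let B and C be the coarse estimators computed from the first and the second
   block of N samples, and A the fine one; (X, A, B, C) and (X, A, C, B) have
   the same law.  The parallelogram identity for A - B and A - C then gives
   Var[A - B] - Var[A - (B + C) / 2] = E[(B - C)^2] / 4.  Since B and C are
   conditionally independent given X with the same conditional mean Z, the
   right-hand side is E[(B - Z)^2] / 2.  Conditional independence is used in the
   form of Fubini's theorem: the law of (X, first block, second block) is a
   product measure, and Z = h(X) with h(x) the integral of the coarse estimator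
   over the block at X = x. *)
Require Import Defs.
From HB Require Import structures.
From mathcomp Require Import all_boot all_order all_algebra.
From mathcomp Require Import all_classical all_reals all_analysis.
From mathcomp Require Import measurable_realfun.
From mathcomp Require Import ring lra.
Import Order.TTheory GRing.Theory Num.Theory.
Import numFieldNormedType.Exports.

Local Open Scope classical_set_scope.
Local Open Scope ring_scope.
Local Open Scope ereal_scope.

(** * Classes of sets that determine finite measures *)

Section determining_classes.
Context {R : realType}.
Set Implicit Arguments.
Unset Strict Implicit.

(* G determines finite measures; a semantic substitute for "G is a pi-system
   generating the sigma-algebra" that is stable under products. *)
Definition determining d (E : measurableType d) (G : set (set E)) : Prop :=
  G `<=` measurable /\
  forall m1 m2 : {measure set E -> \bar R},
    m1 setT < +oo -> m2 setT < +oo ->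
    (forall A, G A -> m1 A = m2 A) -> forall A, measurable A -> m1 A = m2 A.

Lemma determining_measurable d (E : measurableType d) :
  determining (measurable : set (set E)).
Proof. by split. Qed.

(** Uniqueness of measures on a generating pi-system. The constant sequence [setT] serves as the
    exhausting sequence, since the total mass is finite. *)
Lemma determining_pi_system d (E : measurableType d) (G : set (set E)) :
  G `<=` measurable -> measurable `<=` <<s G >> -> setI_closed G -> G setT ->
  determining G.
Proof.
move=> Gm mG GI GT; split => // m1 m2 m1oo _ m12 A mA.
apply: (g_sigma_algebra_measure_unique G Gm (fun=> setT)) => //.
- by rewrite bigcup_const//; exists 0%N.
- exact: mG.
Qed.

Definition boxes d (E : measurableType d) n : set (set (n.-tuple E)) :=
  [set [set t | forall i, B i (tnth t i)]
    | B in [set B : 'I_n -> set E | forall i, measurable (B i)]].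

Lemma measurable_box d (E : measurableType d) n (B : 'I_n -> set E) :
  (forall i, measurable (B i)) ->
  measurable [set t : n.-tuple E | forall i, B i (tnth t i)].
Proof.
move=> mB.
rewrite (_ : mkset _ = \bigcap_(i in [set: 'I_n]) ((@tnth n E)^~ i @^-1` B i)).
  apply: fin_bigcap_measurable => // i _.
  by rewrite -[X in measurable X]setTI; apply: measurable_tnth.
by apply/seteqP; split => [t Bt i _|t Bt i]; exact: Bt.
Qed.

Lemma determining_boxes d (E : measurableType d) n : determining (@boxes d E n).
Proof.
apply: determining_pi_system.
- by move=> _ [B mB <-]; exact: measurable_box.
- apply: smallest_sub; first exact: smallest_sigma_algebra.
  rewrite -bigcup_seq => A [i _ [B mB <-]]; apply: sub_sigma_algebra.
  (* A generator of the tuple sigma-algebra constrains the single coordinate [i]; it is the box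
     whose other sides are full. *)
  exists (fun j => if j == i then B else setT).
    by move=> j /=; case: ifP.
  apply/seteqP; split=> [t /= /(_ i)|t [_ Bt] j /=]; first by rewrite eqxx.
  by case: eqP => [->|].
- move=> _ _ [B mB <-] [C mC <-]; exists (fun i => B i `&` C i).
    by move=> i; exact: measurableI.
  apply/seteqP; split=> [t BC|t [Bt Ct] i]; last by split.
  by split=> i; case: (BC i).
- by exists (fun=> setT) => //; apply/seteqP; split.
Qed.

(** One factor is enlarged at a time. For fixed [A] in [G1], the map sending [B] to the mass of
    [A * B] is a finite measure, namely the image under [snd] of a restriction, so agreement on [G2]
    extends to all measurable [B]. The same argument along [fst] then frees [A], and the measurable
    rectangles form a generating pi-system. *)
Lemma determining_rectangles d1 d2 (E1 : measurableType d1)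
    (E2 : measurableType d2) (G1 : set (set E1)) (G2 : set (set E2)) :
  determining G1 -> determining G2 ->
  determining [set A `*` B | A in G1 & B in G2].
Proof.
move=> [mG1 G1u] [mG2 G2u]; split.
  by move=> _ [A GA [B GB <-]]; apply: measurableX; [exact: mG1|exact: mG2].
move=> m1 m2 m1oo m2oo m12.
have lty (m : {measure set (E1 * E2)%type -> \bar R}) D (mD : measurable D) :
    m setT < +oo -> mrestr m mD setT < +oo.
  move=> moo; apply: le_lt_trans moo; rewrite /mrestr setTI.
  by apply: le_measure; rewrite ?inE.
have mXT (A : set E1) : measurable A -> measurable (A `*` [set: E2]).
  by move=> mA; exact: measurableX.
have mTX (B : set E2) : measurable B -> measurable ([set: E1] `*` B).
  by move=> mB; exact: measurableX.
have XE (A : set E1) (B : set E2) :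
    A `*` B = snd @^-1` B `&` (A `*` [set: E2]).
  by apply/seteqP; split=> [[x y] []|[x y] [? []]].
have XE' (A : set E1) (B : set E2) :
    A `*` B = fst @^-1` A `&` ([set: E1] `*` B).
  by apply/seteqP; split=> [[x y] []|[x y] [? []]].
have step1 A B : G1 A -> measurable B -> m1 (A `*` B) = m2 (A `*` B).
  move=> GA mB; have mA := mXT _ (mG1 _ GA); rewrite XE.
  have := G2u (pushforward (mrestr m1 mA) snd) (pushforward (mrestr m2 mA) snd).
  apply => //; [exact: lty|exact: lty|move=> C GC].
  by rewrite /= /pushforward /mrestr -XE; apply: m12; exists A => //; exists C.
have step2 A B : measurable A -> measurable B -> m1 (A `*` B) = m2 (A `*` B).
  move=> mA mB; have mB' := mTX _ mB; rewrite XE'.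
  have := G1u (pushforward (mrestr m1 mB') fst)
              (pushforward (mrestr m2 mB') fst).
  apply => //; [exact: lty|exact: lty|move=> C GC].
  by rewrite /= /pushforward /mrestr -XE'; exact: step1.
have [_] : determining
    [set A `*` B | A in @measurable _ E1 & B in @measurable _ E2].
  apply: determining_pi_system.
  - by move=> _ [A mA [B mB <-]]; exact: measurableX.
  - by rewrite measurable_prod_measurableType.
  - move=> _ _ [A mA [B mB <-]] [A' mA' [B' mB' <-]].
    exists (A `&` A'); first exact: measurableI.
    by exists (B `&` B'); [exact: measurableI|rewrite setXI].
  - by exists setT => //; exists setT => //; rewrite setXTT.
by apply => // _ [A mA [B mB <-]]; exact: step2.
Qed.

End determining_classes.

(** * Pairs and tuples of random variables, bundled so that their laws can be formed *)

Section random_vectors.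
Set Implicit Arguments.
Unset Strict Implicit.
Context {d0 d1 d2 : measure_display} {T : measurableType d0}
  {E1 : measurableType d1} {E2 : measurableType d2}.

Definition pair_rv (X : {mfun T >-> E1}) (Y : {mfun T >-> E2}) (w : T) :=
  (X w, Y w).

Let measurable_pair_rv X Y : measurable_fun setT (pair_rv X Y).
Proof. exact: measurable_fun_pair. Qed.

HB.instance Definition _ X Y :=
  isMeasurableFun.Build _ _ T (E1 * E2)%type (pair_rv X Y)
    (measurable_pair_rv X Y).

Definition tuple_rv n (G : 'I_n -> {mfun T >-> E1}) (w : T) : n.-tuple E1 :=
  [tuple G i w | i < n].

Let measurable_tuple_rv n (G : 'I_n -> {mfun T >-> E1}) :
  measurable_fun setT (tuple_rv G).
Proof.
apply/measurable_fun_tnthP => i.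
rewrite (_ : _ \o _ = G i); first exact: measurable_funPT.
by apply/funext => w /=; rewrite tnth_mktuple.
Qed.

HB.instance Definition _ n (G : 'I_n -> {mfun T >-> E1}) :=
  isMeasurableFun.Build _ _ T (n.-tuple E1) (tuple_rv G) (measurable_tuple_rv G).

End random_vectors.

(** * Factorization of probabilities under mutual independence *)

Section independence.
Set Implicit Arguments.
Unset Strict Implicit.
Context {d0 : measure_display} {T : measurableType d0} {R : realType}
  (P : probability T R).

(** Passes from duplicate-free lists of indices to families over a finite type, which may mix
    several kinds of index. *)
Lemma mutually_independent_reindex (I : eqType) (G : I -> set (set T))
    (K : finType) (s : K -> I) (A : K -> set T) :
  mutually_independent P G -> (forall i, G i setT) -> injective s ->
  (forall k, G (s k) (A k)) ->
  P (\bigcap_k A k) = \prod_k P (A k).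
Proof.
move=> indG GT s_inj GA.
(* The events are carried from [K] to [I]; injectivity of [s] ensures that [pick] recovers the
   original index. *)
pose A' i := if [pick k | s k == i] is Some k then A k else setT.
have A'E k : A' (s k) = A k.
  rewrite /A'; case: pickP => [k' /eqP/s_inj -> //|/(_ k)].
  by rewrite eqxx.
have := indG [seq s k | k <- enum K] A'.
rewrite map_inj_uniq// enum_uniq big_map big_enum /=.
under eq_bigr do rewrite A'E.
move=> <- //.
  congr (P _); apply/seteqP; split=> [w Aw _ /= /mapP[k _ ->]|w Aw k _].
    by rewrite A'E; exact: Aw.
  by rewrite -A'E; apply: Aw; rewrite /= map_f// mem_enum.
move=> _ /mapP[k _ ->]; rewrite A'E; exact: GA.
Qed.

Context {d1 d2 : measure_display} {E1 : measurableType d1}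
  {E2 : measurableType d2}.
Context (X : {RV P >-> E1}) (U : {RV P >-> E2}) (U_ : nat -> {RV P >-> E2}).
Hypothesis U_U : forall n, same_law (U_ n) U.
Hypothesis indXU : mutually_independent P (joint_sigma X U_).

Let joint_sigmaT o : joint_sigma X U_ o setT.
Proof. by case: o => [n|]; exists setT; rewrite ?preimage_setT ?setTI. Qed.

Lemma law_box n (s : 'I_n -> nat) (B : 'I_n -> set E2) :
  injective s -> (forall i, measurable (B i)) ->
  P [set w | forall i, B i (U_ (s i) w)] = \prod_i distribution P U (B i).
Proof.
move=> s_inj mB.
have := @mutually_independent_reindex _ _ 'I_n (fun i => Some (s i))
  (fun i => U_ (s i) @^-1` B i) indXU joint_sigmaT.
rewrite (_ : \bigcap_k _ = [set w | forall i, B i (U_ (s i) w)]); last first.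
  by apply/seteqP; split=> [w Bw i|w Bw i _]; exact: Bw.
move=> ->.
- by apply: eq_bigr => i _; exact: U_U.
- by move=> i j [/s_inj].
- by move=> i; exists (B i); rewrite ?setTI.
Qed.

Lemma law_boxes n (s t : 'I_n -> nat) (A : set E1) (B C : 'I_n -> set E2) :
  injective s -> injective t -> (forall i j, s i <> t j) ->
  measurable A -> (forall i, measurable (B i)) ->
  (forall i, measurable (C i)) ->
  P (X @^-1` A `&` [set w | forall i, B i (U_ (s i) w)]
       `&` [set w | forall i, C i (U_ (t i) w)]) =
  distribution P X A * \prod_i distribution P U (B i) *
    \prod_i distribution P U (C i).
Proof.
move=> s_inj t_inj st mA mB mC.
(* The three summands index [X], the first block and the second block. The map [k] is injective
   because [s] and [t] are and their ranges are disjoint. *)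
pose k (o : unit + ('I_n + 'I_n)) := match o with
  | inl _ => None | inr (inl i) => Some (s i) | inr (inr i) => Some (t i) end.
pose D (o : unit + ('I_n + 'I_n)) := match o with
  | inl _ => X @^-1` A | inr (inl i) => U_ (s i) @^-1` B i
  | inr (inr i) => U_ (t i) @^-1` C i end.
have := @mutually_independent_reindex _ _ _ k D indXU joint_sigmaT.
rewrite (_ : \bigcap_o _ = X @^-1` A `&` [set w | forall i, B i (U_ (s i) w)]
       `&` [set w | forall i, C i (U_ (t i) w)]); last first.
  apply/seteqP; split=> [w Dw|w [[Aw Bw] Cw] [[]|[i|i]] _].
  - split; first split.
    + exact: (Dw (inl tt)).
    + by move=> i; exact: (Dw (inr (inl i))).
    + by move=> i; exact: (Dw (inr (inr i))).
  - exact: Aw.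
  - exact: Bw.
  - exact: Cw.
move=> ->.
- rewrite big_sumType big_sumType /= muleA; congr (_ * _ * _).
  + by rewrite (big_pred1 tt)// => -[].
  + by apply: eq_bigr => i _; exact: U_U.
  + by apply: eq_bigr => i _; exact: U_U.
- move=> [[]|[i|i]] [[]|[j|j]] //= [].
  + by move/s_inj ->.
  + by move/st.
  + by move/esym/st.
  + by move/t_inj ->.
- move=> [[]|[i|i]] /=.
  + by exists A; rewrite ?setTI.
  + by exists (B i); rewrite ?setTI.
  + by exists (C i); rewrite ?setTI.
Qed.

End independence.

(** * Joint law of [X] and two disjoint blocks of samples *)

Section block_laws.
Set Implicit Arguments.
Unset Strict Implicit.
Context {d0 : measure_display} {T : measurableType d0} {R : realType}
  (P : probability T R).
Context {d1 d2 : measure_display} {E1 : measurableType d1}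
  {E2 : measurableType d2}.
Context (X : {RV P >-> E1}) (U : {RV P >-> E2}) (U_ : nat -> {RV P >-> E2}).
Hypothesis U_U : forall n, same_law (U_ n) U.
Hypothesis indXU : mutually_independent P (joint_sigma X U_).

Definition block n (s : 'I_n -> nat) : {RV P >-> n.-tuple E2} :=
  tuple_rv (fun i => U_ (s i)).

Let preimage_block n (s : 'I_n -> nat) (B : 'I_n -> set E2) :
  block s @^-1` [set t | forall i, B i (tnth t i)] =
  [set w | forall i, B i (U_ (s i) w)].
Proof.
apply/seteqP; split=> w /= + i => /(_ i).
  by rewrite /block /tuple_rv tnth_mktuple.
by rewrite /block /tuple_rv tnth_mktuple.
Qed.

Context (n : nat) (s t : 'I_n -> nat).
Hypotheses (s_inj : injective s) (t_inj : injective t)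
  (st : forall i j, s i <> t j).

Let law_block (a : 'I_n -> nat) (B : 'I_n -> set E2) :
  injective a -> (forall i, measurable (B i)) ->
  distribution P (block a) [set v | forall i, B i (tnth v i)] =
  \prod_i distribution P U (B i).
Proof.
move=> a_inj mB; rewrite -(law_box U_U indXU a_inj mB) -preimage_block.
by [].
Qed.

Let lty d (E : measurableType d) (Q : probability E R) : Q setT < +oo.
Proof. by rewrite probability_setT ltry. Qed.

Let det1 : determining (R := R)
  [set A `*` B | A in (measurable : set (set E1)) & B in @boxes _ E2 n].
Proof.
apply: determining_rectangles; first exact: determining_measurable.
exact: determining_boxes.
Qed.

Let law_pair_box (A : set E1) (B : 'I_n -> set E2) :
  measurable A -> (forall i, measurable (B i)) ->
  P (X @^-1` A `&` [set w | forall i, B i (U_ (s i) w)]) =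
  distribution P X A * \prod_i distribution P U (B i).
Proof.
move=> mA mB.
(* Full sides for the second block make it disappear from both members. *)
have := law_boxes U_U indXU s_inj t_inj st mA mB (fun=> @measurableT _ E2).
rewrite (_ : [set w | forall i, setT (U_ (t i) w)] = setT); last first.
  by apply/seteqP; split.
rewrite setIT => ->.
by rewrite [X in _ * X]big1 ?mule1// => i _; exact: probability_setT.
Qed.

(** Independence of [X] and a block, in the form needed by Fubini's theorem: both measures agree on
    rectangles with a box as second side, and these determine them. *)
Lemma law_pair_block D : measurable D ->
  distribution P (pair_rv X (block s)) D =
  (distribution P X \x distribution P (block s)) D.
Proof.
apply: (det1.2 _ (distribution P X \x distribution P (block s))%E);
  [exact: lty|exact: lty|].
move=> _ [A mA [_ [B mB <-] <-]].
rewrite [RHS]/= product_measure1E//; last exact: measurable_box.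
rewrite [RHS](_ : _ = distribution P X A * \prod_i distribution P U (B i));
  last by congr (_ * _); exact: law_block.
rewrite -law_pair_box// -preimage_block.
by congr (P _); apply/seteqP; split.
Qed.

Let det2 : determining (R := R)
  [set D `*` C | D in
    [set A `*` B | A in (measurable : set (set E1)) & B in @boxes _ E2 n]
    & C in @boxes _ E2 n].
Proof. by apply: determining_rectangles => //; exact: determining_boxes. Qed.

Lemma law_two_blocks D : measurable D ->
  distribution P (pair_rv (pair_rv X (block s)) (block t)) D =
  (distribution P (pair_rv X (block s)) \x distribution P (block t)) D.
Proof.
apply: (det2.2 _
    (distribution P (pair_rv X (block s)) \x distribution P (block t))%E);
  [exact: lty|exact: lty|].
move=> _ [_ [A mA [_ [B mB <-] <-]] [_ [C mC <-] <-]].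
rewrite [RHS]/= product_measure1E//; last 2 first.
- by apply: measurableX => //; exact: measurable_box.
- exact: measurable_box.
rewrite [RHS](_ : _ = distribution P X A * \prod_i distribution P U (B i) *
    \prod_i distribution P U (C i)); last first.
  congr (_ * _); last exact: law_block.
  rewrite -law_pair_box// -preimage_block.
  by congr (P _); apply/seteqP; split.
rewrite -(law_boxes U_U indXU s_inj t_inj st)// -!preimage_block.
by congr (P _); apply/seteqP; split.
Qed.

(** Exchangeability of the blocks: on products of boxes the probability depends only on the laws of
    [X] and [U], and the index maps do not occur in the right-hand side of [lawE]. *)
Lemma law_swap_blocks D : measurable D ->
  distribution P (pair_rv (pair_rv X (block s)) (block t)) D =
  distribution P (pair_rv (pair_rv X (block t)) (block s)) D.
Proof.
have lawE (a b : 'I_n -> nat) A B C : injective a -> injective b ->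
    (forall i j, a i <> b j) -> measurable A -> (forall i, measurable (B i)) ->
    (forall i, measurable (C i)) ->
    distribution P (pair_rv (pair_rv X (block a)) (block b))
      (A `*` [set v | forall i, B i (tnth v i)]
         `*` [set v | forall i, C i (tnth v i)]) =
    distribution P X A * \prod_i distribution P U (B i) *
    \prod_i distribution P U (C i).
  move=> a_inj b_inj ab mA mB mC.
  rewrite -(law_boxes U_U indXU a_inj b_inj ab)// -!preimage_block.
  by congr (P _); apply/seteqP; split.
apply: (det2.2 _ (distribution P (pair_rv (pair_rv X (block t)) (block s))));
  [exact: lty|exact: lty|].
move=> _ [_ [A mA [_ [B mB <-] <-]] [_ [C mC <-] <-]].
apply: etrans; first exact: lawE.
by apply/esym; apply: lawE => // i j /esym/st.
Qed.

End block_laws.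

(** * Freezing one variable: Fubini's theorem for independent variables *)

Section freezing.
Set Implicit Arguments.
Unset Strict Implicit.
Context {d0 : measure_display} {T : measurableType d0} {R : realType}
  (P : probability T R).
Context {d1 d2 : measure_display} {E1 : measurableType d1}
  {E2 : measurableType d2}.
Implicit Types (X : {RV P >-> E1}) (V : {RV P >-> E2}).

Lemma ae_eq_integrable d (E : measurableType d)
    (mu : {measure set E -> \bar R}) (f g : E -> \bar R) :
  ae_eq mu setT f g -> measurable_fun setT g -> mu.-integrable setT f ->
  mu.-integrable setT g.
Proof.
move=> fg mg /integrableP[mf foo]; apply/integrableP; split => //.
rewrite (ae_eq_integral (abse \o f))//; try exact: measurableT_comp.
exact/ae_eq_abse/ae_eq_sym.
Qed.

Lemma Lfun1_ae_eq (f g : T -> R) : f \in Lfun P 1 -> measurable_fun setT g ->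
  {ae P, forall w, f w = g w} ->
  g \in Lfun P 1 /\ 'E_P[f] = 'E_P[g].
Proof.
move=> /Lfun1_integrable intf mg fg.
have fgE : ae_eq P setT (EFin \o f) (EFin \o g).
  by apply: filterS fg => w /= ->.
have mf := measurable_int _ intf.
have mg' : measurable_fun setT (EFin \o g) by exact/measurable_EFinP.
split; first exact/Lfun1_integrable/(ae_eq_integrable fgE mg' intf).
by rewrite unlock; exact: ae_eq_integral fgE.
Qed.

Lemma ae_distribution X (Q : E1 -> Prop) :
  {ae distribution P X, forall x, Q x} -> {ae P, forall w, Q (X w)}.
Proof.
move=> [N [mN N0 QN]]; exists (X @^-1` N); split => //.
- by rewrite -[X in measurable X]setTI; exact: measurable_funPT.
- by move=> w; exact: QN.
Qed.

(** When [X] and [V] are independent and [phi (X, V)] is integrable, this is a version of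
    E[phi(X, V) | X = x]. It is the real part, by [fine], of an extended integral, meaningful for
    almost every [x] only. *)
Definition slice V (phi : E1 * E2 -> R) (x : E1) : R :=
  (\int[distribution P V]_v phi (x, v))%R.

Context (X : {RV P >-> E1}) (V : {RV P >-> E2}).
Hypothesis lawXV : forall D, measurable D ->
  distribution P (pair_rv X V) D = (distribution P X \x distribution P V) D.
Variable phi : E1 * E2 -> R.
Hypothesis mphi : measurable_fun setT phi.
Hypothesis phi1 : (fun w => phi (X w, V w)) \in Lfun P 1.

Let mEphi : measurable_fun setT (EFin \o phi).
Proof. exact/measurable_EFinP. Qed.

Lemma integrable_product_law :
  (distribution P X \x distribution P V).-integrable setT (EFin \o phi).
Proof.
have /Lfun1_integrable/integrableP[_ phioo] := phi1.
apply/integrableP; split => //.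
rewrite (eq_measure_integral (distribution P (pair_rv X V))); last first.
  by move=> D mD _; apply/esym; exact: lawXV.
rewrite ge0_integral_distribution//.
exact: measurableT_comp.
Qed.

Lemma measurable_slice : measurable_fun setT (slice V phi).
Proof.
have := measurable_fubini_F integrable_product_law.
by move=> /(measurableT_comp (fine_measurable measurableT)); apply.
Qed.

(** Fubini's theorem gives the iterated integral with an extended real inner integral; the latter is
    integrable, hence almost everywhere finite and equal to [slice]. *)
Lemma expectation_slice :
  (slice V phi \o X) \in Lfun P 1 /\
  'E_P[fun w => phi (X w, V w)] = 'E_P[slice V phi \o X].
Proof.
have intF := integrable_fubini_F integrable_product_law.
have Fslice : ae_eq (distribution P X) setT
    (fubini_F (distribution P V) (EFin \o phi)) (EFin \o slice V phi).
  apply: filterS (integrable_ae measurableT intF) => x /= /(_ Logic.I) Ffin _.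
  by rewrite /slice /Rintegral fineK.
have mslice : measurable_fun setT (EFin \o slice V phi).
  exact/measurable_EFinP/measurable_slice.
have intS : (distribution P X).-integrable setT (EFin \o slice V phi).
  exact: ae_eq_integrable Fslice mslice intF.
have intSX : P.-integrable setT (EFin \o (slice V phi \o X)).
  move/integrableP : intS => [_].
  rewrite ge0_integral_distribution//; last exact: measurableT_comp.
  move=> Soo; apply/integrableP; split => //.
  by apply: (measurableT_comp mslice); exact: measurable_funPT.
split; first exact/Lfun1_integrable.
have /Lfun1_integrable intphi := phi1.
rewrite unlock.
transitivity (\int[distribution P (pair_rv X V)]_z (EFin \o phi) z).
  by rewrite integral_distribution.
rewrite (eq_measure_integral (distribution P X \x distribution P V)%E); last first.
  by move=> D mD _; exact: lawXV.
rewrite -(integral12_prod_meas1 integrable_product_law).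
transitivity (\int[distribution P X]_x (EFin \o slice V phi) x).
  by apply: ae_eq_integral Fslice => //; exact: measurable_int intF.
by rewrite integral_distribution.
Qed.

End freezing.

(** * Slices as conditional expectations *)

Section freezing_mul.
Set Implicit Arguments.
Unset Strict Implicit.
Context {d0 : measure_display} {T : measurableType d0} {R : realType}
  (P : probability T R).
Context {d1 d2 : measure_display} {E1 : measurableType d1}
  {E2 : measurableType d2}.
Context (X : {RV P >-> E1}) (V : {RV P >-> E2}).
Hypothesis lawXV : forall D, measurable D ->
  distribution P (pair_rv X V) D = (distribution P X \x distribution P V) D.
Variable phi : E1 * E2 -> R.
Hypothesis mphi : measurable_fun setT phi.
Hypothesis phi1 : (fun w => phi (X w, V w)) \in Lfun P 1.

(** The factor [psi x] is a constant of the inner integral. It can be pulled out wherever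
    [phi (x, _)] is integrable, that is for almost every [x]. *)
Lemma expectation_slice_mul (psi : E1 -> R) : measurable_fun setT psi ->
  (fun w => psi (X w) * phi (X w, V w))%R \in Lfun P 1 ->
  (fun w => psi (X w) * slice V phi (X w))%R \in Lfun P 1 /\
  'E_P[fun w => (psi (X w) * phi (X w, V w))%R] =
  'E_P[fun w => (psi (X w) * slice V phi (X w))%R].
Proof.
move=> mpsi psiphi1.
pose psiphi z := (psi z.1 * phi z)%R.
have mpsiphi : measurable_fun setT psiphi.
  by apply: measurable_funM => //; exact: measurableT_comp.
have [L1 ->] := expectation_slice lawXV mpsiphi psiphi1.
apply: (Lfun1_ae_eq L1).
  apply: measurable_funM; first exact: measurableT_comp.
  by apply: measurableT_comp => //; exact: (measurable_slice lawXV).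
apply: (ae_distribution (X := X)
  (Q := fun x => slice V psiphi x = psi x * slice V phi x)%R).
apply: filterS (ae_integrable1 (integrable_product_law lawXV mphi phi1)).
by move=> x intx; rewrite /slice /psiphi/= RintegralZl.
Qed.

(** Every event of sigma([X]) is a preimage of some [B], and the defining equation on it is the
    previous lemma with the indicator of [B] as [psi]. *)
Lemma cond_expectation_slice :
  is_cond_expectation X (fun w => phi (X w, V w)) (slice V phi \o X).
Proof.
have mslice := measurable_slice lawXV mphi phi1.
have [S1 _] := expectation_slice lawXV mphi phi1.
split => //.
  move=> B mB; exists (slice V phi @^-1` B); last by rewrite setTI.
  by rewrite -[X in measurable X]setTI; exact: mslice.
move=> _ [B mB <-]; rewrite setTI.
have mXB : measurable (X @^-1` B).
  by rewrite -[X in measurable X]setTI; exact: measurable_funPT.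
have memE w : (w \in X @^-1` B) = (X w \in B) by apply/idP/idP; rewrite !inE.
have indE (g : T -> R) : \int[P]_(w in X @^-1` B) (g w)%:E =
    'E_P[fun w => (\1_B (X w) * g w)%R].
  rewrite unlock integral_mkcond; apply: eq_integral => w _.
  rewrite patchE indicE -memE.
  by case: ifP => _; rewrite ?mul1r ?mul0r.
rewrite !indE; apply/esym.
apply: (proj2 (expectation_slice_mul _ _)) => //.
apply/Lfun1_integrable.
rewrite (_ : _ \o _ =
    (EFin \o (fun w => phi (X w, V w))) \_ (X @^-1` B)); last first.
  apply/funext => w; rewrite patchE /= indicE -memE.
  by case: ifP => _; rewrite ?mul1r ?mul0r.
apply: (proj1 (integrable_mkcond _ mXB)).
by apply: (integrableS measurableT) => //; exact/Lfun1_integrable.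
Qed.

End freezing_mul.

(** * Second moments of square-integrable functions *)

Section square_integrable.
Set Implicit Arguments.
Unset Strict Implicit.
Context {d0 : measure_display} {T : measurableType d0} {R : realType}
  (P : probability T R).
Implicit Types f g Y Z : T -> R.

Lemma Lfun_measurable f p : f \in Lfun P p -> measurable_fun setT f.
Proof. by rewrite inE => /andP[/[!inE]]. Qed.

Lemma Lfun2_sqr f : measurable_fun setT f ->
  f \in Lfun P 2%:E <-> (fun w => f w ^+ 2)%R \in Lfun P 1.
Proof.
move=> mf; split=> [f2|/Lfun1_integrable/integrableP[_ foo]].
  exact/Lfun1_integrable/Lfun2_integrable_sqr.
rewrite inE; apply/andP; split; rewrite inE//= /finite_norm unlock /Lnorm.
rewrite poweR_lty//; apply: le_lt_trans foo.
rewrite le_eqVlt; apply/orP; left; apply/eqP; apply: eq_integral => w _ /=.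
by rewrite powR_mulrn// normrX.
Qed.

Lemma Lfun2D f g : f \in Lfun P 2%:E -> g \in Lfun P 2%:E ->
  (f \+ g)%R \in Lfun P 2%:E.
Proof. by move=> f2 g2; rewrite rpredD ?lee1n. Qed.

Lemma Lfun2B f g : f \in Lfun P 2%:E -> g \in Lfun P 2%:E ->
  (f \- g)%R \in Lfun P 2%:E.
Proof. by move=> f2 g2; rewrite rpredB ?lee1n. Qed.

Lemma Lfun2_ae_eq f g : f \in Lfun P 2%:E -> measurable_fun setT g ->
  {ae P, forall w, f w = g w} ->
  g \in Lfun P 2%:E /\
  'E_P[fun w => (f w ^+ 2)%R] = 'E_P[fun w => (g w ^+ 2)%R].
Proof.
move=> f2 mg fg; have mf := Lfun_measurable f2.
have /(Lfun2_sqr mf) f21 := f2.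
have [] := @Lfun1_ae_eq _ _ _ P _ (fun w => g w ^+ 2)%R f21.
- exact: measurable_funX.
- by apply: filterS fg => w ->.
- by move=> g21 ->; split => //; apply/Lfun2_sqr.
Qed.

Lemma sqr_Lnorm2 f : f \in Lfun P 2%:E ->
  'N[P]_2%:E[EFin \o f] ^+ 2 = 'E_P[fun w => (f w ^+ 2)%R].
Proof.
move=> f2; have mf := Lfun_measurable f2.
have /(Lfun2_sqr mf) f21 := f2.
have := expectation_fin_num f21.
have : 0 <= 'E_P[fun w => (f w ^+ 2)%R].
  by apply: expectation_ge0 => w; exact: sqr_ge0.
rewrite expectation.unlock Lnorm.unlock.
rewrite (_ : \int[P]_w (`|f w| `^ 2)%:E = \int[P]_w (f w ^+ 2)%:E); last first.
  by apply: eq_integral => w _; rewrite powR_mulrn// real_normK// num_real.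
case: (\int[P]_w (f w ^+ 2)%:E) => [r| |]//; rewrite lee_fin => r0 _.
rewrite poweR_EFin -EFin_expe; congr EFin.
by rewrite -(powR_mulrn 2 (powR_ge0 _ _)) -powRrM mulVf// powRr1.
Qed.

Lemma expectation_sqr_eq0 f : f \in Lfun P 2%:E ->
  'E_P[fun w => (f w ^+ 2)%R] = 0 <-> {ae P, forall w, f w = 0%R}.
Proof.
move=> f2; have mf := Lfun_measurable f2; rewrite unlock.
have mf2 : measurable_fun setT (EFin \o (fun w => f w ^+ 2)%R).
  by apply/measurable_EFinP; exact: measurable_funX.
have absE : \int[P]_w `|(EFin \o (fun w => f w ^+ 2)%R) w| =
    \int[P]_w (f w ^+ 2)%:E.
  by apply: eq_integral => w _ /=; rewrite ger0_norm// sqr_ge0.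
rewrite -absE; split=> [/(ae_eq_integral_abs P measurableT mf2).1|f0].
  by apply: filterS => w /= /(_ Logic.I)[] /eqP; rewrite sqrf_eq0 => /eqP.
apply/(ae_eq_integral_abs P measurableT mf2).
by apply: filterS f0 => w /= -> _; rewrite expr0n.
Qed.

Lemma expectation_sqrB f g : f \in Lfun P 2%:E -> g \in Lfun P 2%:E ->
  'E_P[fun w => ((f w - g w) ^+ 2)%R] =
  'E_P[fun w => (f w ^+ 2)%R] + 'E_P[fun w => (g w ^+ 2)%R]
    - 2%:E * 'E_P[fun w => (f w * g w)%R].
Proof.
move=> f2 g2.
have /(Lfun2_sqr (Lfun_measurable f2)) f21 := f2.
have /(Lfun2_sqr (Lfun_measurable g2)) g21 := g2.
have fg1 := Lfun2_mul_Lfun1 f2 g2.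
rewrite -(expectationZl 2 fg1) -expectationD// -expectationB//.
- by congr expectation; apply/funext => w /=; ring.
- exact: rpredD.
- exact: Lfun_scale.
Qed.

End square_integrable.

(** * Almost sure uniqueness of the conditional expectation *)

Section cond_expectation_unique.
Set Implicit Arguments.
Unset Strict Implicit.
Context {d0 : measure_display} {T : measurableType d0} {R : realType}
  (P : probability T R).
Context {d1 : measure_display} {E : measurableType d1} (X : {RV P >-> E}).
Implicit Types Y Z : T -> R.

Lemma g_sigma_algebra_preimage_measurable A :
  g_sigma_algebra_preimage X A -> measurable A.
Proof. by move=> [B mB <-]; exact: measurable_funPT. Qed.

(** The event [D] where [Z2 < Z1] lies in sigma([X]), so [Z1] and [Z2] have the same integral over
    it. Their difference is positive on [D] and integrates to zero there, so [D] is null. *)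
Let cond_expectation_le Y Z1 Z2 : is_cond_expectation X Y Z1 ->
  is_cond_expectation X Y Z2 -> {ae P, forall w, (Z1 w <= Z2 w)%R}.
Proof.
move=> [XZ1 Z11 Z1Y] [XZ2 Z21 Z2Y].
pose D := [set w | (Z2 w < Z1 w)%R].
have XD : g_sigma_algebra_preimage X D.
  (* Measurability is taken with respect to sigma([X]), not the ambient sigma-algebra, so that the
     comparison event lands in sigma([X]). *)
  have mZ (Z : T -> R) :
      (forall B, measurable B -> g_sigma_algebra_preimage X (Z @^-1` B)) ->
      measurable_fun [set: g_sigma_algebra_preimageType X] Z.
    by move=> XZ _ B mB; rewrite setTI; exact: XZ.
  have := measurable_fun_ltr (mZ _ XZ2) (mZ _ XZ1).
  by move=> /(_ measurableT [set true]); rewrite setTI; exact.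
have mD := g_sigma_algebra_preimage_measurable XD.
move: (Z11) (Z21) => /Lfun1_integrable iZ1 /Lfun1_integrable iZ2.
have iZ1D := integrableS measurableT mD (@subsetT _ _) iZ1.
have iZ2D := integrableS measurableT mD (@subsetT _ _) iZ2.
have : \int[P]_(w in D) ((Z1 w)%:E - (Z2 w)%:E) = 0.
  rewrite integralB_EFin// Z1Y// Z2Y// subee//.
  by rewrite -Z1Y//; exact: integrable_fin_num.
rewrite (_ : \int[P]_(w in D) _ =
    \int[P]_(w in D) `|(Z1 w)%:E - (Z2 w)%:E|); last first.
  apply: eq_integral => w; rewrite inE => Dw.
  by rewrite gee0_abs// sube_ge0// lee_fin ltW.
move=> /(ae_eq_integral_abs P mD _).1 Z12.
apply: filterS (Z12 _) => [w /= DZ|]; last first.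
  by apply: emeasurable_funB; [exact: measurable_int iZ1D
                              |exact: measurable_int iZ2D].
rewrite leNgt; apply/negP => Dw; have [/eqP] := DZ Dw.
by rewrite subr_eq0 => /eqP Z12w; move: Dw; rewrite Z12w ltxx.
Qed.

Lemma cond_expectation_unique Y Z1 Z2 : is_cond_expectation X Y Z1 ->
  is_cond_expectation X Y Z2 -> {ae P, forall w, Z1 w = Z2 w}.
Proof.
move=> Z1Y Z2Y.
apply: filterS2 (cond_expectation_le Z1Y Z2Y) (cond_expectation_le Z2Y Z1Y).
by move=> w Z12 Z21; apply/eqP; rewrite eq_le Z12.
Qed.

End cond_expectation_unique.

(** * Transfer of integrability and expectation between variables of equal law *)

Section same_law_transfer.
Set Implicit Arguments.
Unset Strict Implicit.
Context {d0 : measure_display} {T : measurableType d0} {R : realType}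
  (P : probability T R).
Context {d1 : measure_display} {E : measurableType d1}.
Context (X Y : {RV P >-> E}) (lawXY : same_law X Y).

Lemma same_law_Lfun1 (g : E -> R) : measurable_fun setT g ->
  g \o X \in Lfun P 1 ->
  g \o Y \in Lfun P 1 /\ 'E_P[g \o X] = 'E_P[g \o Y].
Proof.
move=> mg /Lfun1_integrable intgX.
have mEg : measurable_fun setT (EFin \o g) by exact/measurable_EFinP.
have lawE (k : E -> \bar R) :
    \int[distribution P X]_x k x = \int[distribution P Y]_x k x.
  by apply: eq_measure_integral => D mD _; exact: lawXY.
have intgY : P.-integrable setT (EFin \o (g \o Y)).
  have /integrableP[_] := intgX.
  have mabs : measurable_fun setT (abse \o (EFin \o g)).
    exact: measurableT_comp.
  have absE : \int[P]_w `|(g (X w))%:E| = \int[P]_w `|(g (Y w))%:E|.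
    have abs0 y : 0 <= (abse \o (EFin \o g)) y by exact: abse_ge0.
    have eX := ge0_integral_distribution X mabs abs0.
    have eY := ge0_integral_distribution Y mabs abs0.
    exact: (etrans (esym eX) (etrans (lawE _) eY)).
  rewrite [X in X < _]absE => gYoo.
  apply/integrableP; split => //.
  by apply: (measurableT_comp mEg); exact: measurable_funPT.
split; first exact/Lfun1_integrable.
rewrite unlock; transitivity (\int[distribution P X]_x (EFin \o g) x).
  by rewrite integral_distribution.
by apply: etrans (lawE _) _; rewrite integral_distribution.
Qed.

Lemma same_law_Lfun2 (g : E -> R) : measurable_fun setT g ->
  g \o X \in Lfun P 2%:E -> g \o Y \in Lfun P 2%:E.
Proof.
move=> mg gX2.
have mgY : measurable_fun setT (g \o Y) by exact: measurableT_comp.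
apply/(Lfun2_sqr P mgY).
apply: (proj1 (same_law_Lfun1 (measurable_funX 2 mg) _)).
exact/(Lfun2_sqr P (Lfun_measurable gX2)).
Qed.

End same_law_transfer.

(** * The variance identity for two exchangeable blocks [V] and [V'] *)

Section antithetic.
Set Implicit Arguments.
Unset Strict Implicit.
Context {d0 : measure_display} {T : measurableType d0} {R : realType}
  (P : probability T R).
Context {d1 d2 : measure_display} {E1 : measurableType d1}
  {E2 : measurableType d2}.
Context (X : {RV P >-> E1}) (V V' : {RV P >-> E2}).
Hypothesis lawXV : forall D, measurable D ->
  distribution P (pair_rv X V) D = (distribution P X \x distribution P V) D.
(** The block to be integrated out comes last: [V] is averaged while [(X, V')] is held fixed. *)
Hypothesis lawXVV : forall D, measurable D ->
  distribution P (pair_rv (pair_rv X V') V) D =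
  (distribution P (pair_rv X V') \x distribution P V) D.
Hypothesis swapV :
  same_law (P := P) (pair_rv (pair_rv X V) V') (pair_rv (pair_rv X V') V).

Variables (a : E1 * E2 * E2 -> R) (b : E1 * E2 -> R).
Hypotheses (ma : measurable_fun setT a) (mb : measurable_fun setT b).
Hypothesis a_sym : forall x v v', a (x, v, v') = a (x, v', v).

Let A w := a (X w, V w, V' w).
Let B w := b (X w, V w).
Let C w := b (X w, V' w).

Hypotheses (A2 : A \in Lfun P 2%:E) (B2 : B \in Lfun P 2%:E).

Let Z : T -> R := slice V b \o X.

Let mB : measurable_fun setT B. Proof. exact: Lfun_measurable B2. Qed.

Let Pfin : P setT \is a fin_num. Proof. exact: fin_num_measure. Qed.

Let B1 : B \in Lfun P 1. Proof. exact: Lfun_subset12 Pfin _ B2. Qed.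

Let mh : measurable_fun setT (slice V b).
Proof. exact: (measurable_slice lawXV mb B1). Qed.

(** A marginal of [swapV]: the last block is left unconstrained. *)
Let swapXV : same_law (P := P) (pair_rv X V) (pair_rv X V').
Proof.
move=> D mD; have mDT : measurable (D `*` [set: E2]) by exact: measurableX.
have DT (W W' : {RV P >-> E2}) : distribution P (pair_rv X W) D =
    distribution P (pair_rv (pair_rv X W) W') (D `*` setT).
  by congr (P _); apply/seteqP; split=> [w //|w []].
by rewrite (DT V V') (DT V' V); exact: swapV.
Qed.

Let C2 : C \in Lfun P 2%:E.
Proof. exact: (same_law_Lfun2 swapXV mb). Qed.

Let C1 : C \in Lfun P 1. Proof. exact: Lfun_subset12 Pfin _ C2. Qed.

Let EC : 'E_P[B] = 'E_P[C].
Proof. exact: (proj2 (same_law_Lfun1 swapXV mb B1)). Qed.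

Let ECC : 'E_P[fun w => (B w ^+ 2)%R] = 'E_P[fun w => (C w ^+ 2)%R].
Proof.
apply: (proj2 (same_law_Lfun1 swapXV (measurable_funX 2 mb) _)).
exact/(Lfun2_sqr P mB).
Qed.

(* Given X, the variables B and C are independent with common mean Z: freezing
   (X, V') turns E[C B] into E[C Z] = E[B Z], and freezing X turns that into
   E[Z^2].  Integrability of Z^2 comes out of Fubini along the way. *)
Let Z2_ECB : Z \in Lfun P 2%:E /\
  'E_P[fun w => (B w * C w)%R] = 'E_P[fun w => (Z w ^+ 2)%R] /\
  'E_P[fun w => (B w * Z w)%R] = 'E_P[fun w => (Z w ^+ 2)%R].
Proof.
(* Since [b'] ignores the middle component, its slice at [(x, v')] is the slice of [b] at [x]. *)
pose b' (z : E1 * E2 * E2) := b (z.1.1, z.2).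
have mb' : measurable_fun setT b'.
  apply: measurableT_comp => //; apply: measurable_fun_pair => //.
  exact: measurableT_comp.
have CB1 : (fun w => C w * B w)%R \in Lfun P 1 by exact: Lfun2_mul_Lfun1.
have [CZ1 CBE] := expectation_slice_mul lawXVV mb' B1 mb CB1.
pose bh z := (b z * slice V b z.1)%R.
have mbh : measurable_fun setT bh.
  by apply: measurable_funM => //; exact: measurableT_comp.
have swapVX : same_law (P := P) (pair_rv X V') (pair_rv X V).
  by move=> D mD; rewrite swapXV.
have [BZ1 BZE] := same_law_Lfun1 swapVX mbh CZ1.
have ZB1 : (fun w => slice V b (X w) * b (X w, V w))%R \in Lfun P 1.
  have -> : (fun w => slice V b (X w) * b (X w, V w))%R = bh \o pair_rv X V;
    last exact: BZ1.
  by apply/funext => w /=; rewrite mulrC.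
have [ZZ1 ZBE] := expectation_slice_mul lawXV mb B1 mh ZB1.
have BZ : 'E_P[fun w => (B w * Z w)%R] = 'E_P[fun w => (Z w ^+ 2)%R].
  transitivity 'E_P[fun w => (slice V b (X w) * b (X w, V w))%R].
    by congr expectation; apply/funext => w; rewrite mulrC.
  by rewrite ZBE; congr expectation; apply/funext => w; rewrite expr2.
split; last split => //.
  apply/(Lfun2_sqr P); first exact: measurableT_comp.
  have -> : (fun w => Z w ^+ 2)%R =
      (fun w => slice V b (X w) * slice V b (X w))%R; last exact: ZZ1.
  by apply/funext => w; rewrite expr2.
rewrite -BZ; transitivity 'E_P[fun w => (C w * B w)%R].
  by congr expectation; apply/funext => w; rewrite mulrC.
by rewrite [LHS]CBE; exact: BZE.
Qed.

(** Expanding the squares, the left-hand side is 2 E[B^2] - 2 E[Z^2], while E[(B - Z)^2] = E[B^2] -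
    E[Z^2]. *)
Let EBC : 'E_P[fun w => ((B w - C w) ^+ 2)%R] =
  2%:E * 'E_P[fun w => ((B w - Z w) ^+ 2)%R].
Proof.
have [Z2 [BC BZ]] := Z2_ECB.
rewrite !expectation_sqrB// -ECC BC BZ.
have /(Lfun2_sqr P mB)/expectation_fin_num/fineK <- := B2.
have /(Lfun2_sqr P (Lfun_measurable Z2))/expectation_fin_num/fineK <- := Z2.
by rewrite -!EFinM -!EFinN -!EFinD; congr EFin; ring.
Qed.

Let S w := (A w - B w)%R.
Let M w := (A w - 2^-1 * (B w + C w))%R.

Let S2 : S \in Lfun P 2%:E.
Proof. exact: (Lfun2B A2 B2). Qed.

Let M2 : M \in Lfun P 2%:E.
Proof.
rewrite (_ : M = A \- (2^-1 \o* (B \+ C)))%R; last first.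
  by apply/funext => w; rewrite /M /= mulrC.
by apply: Lfun2B => //; apply: Lfun_scale; [rewrite ler1n|exact: Lfun2D].
Qed.

(** Follows from E[B] = E[C]. The squared means thus cancel in the difference of the variances,
    which leaves second moments only. *)
Let EMS : 'E_P[M] = 'E_P[S].
Proof.
have A1 : A \in Lfun P 1 by exact: Lfun_subset12 Pfin _ A2.
rewrite (_ : M = A \- (2^-1 \o* (B \+ C)))%R; last first.
  by apply/funext => w; rewrite /M /= mulrC.
rewrite expectationB//; last by apply: Lfun_scale => //; exact: rpredD.
rewrite expectationZl; last exact: rpredD.
rewrite expectationD// -EC [in RHS]expectationB//.
have /fineK <- := expectation_fin_num B1.
by rewrite -EFinD -EFinM; congr (_ - _%:E); field.
Qed.

(** Exchanging the blocks leaves [A] unchanged, by symmetry of [a], and turns [B] into [C]. *)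
Let ESS : 'E_P[fun w => (S w ^+ 2)%R] = 'E_P[fun w => ((A w - C w) ^+ 2)%R].
Proof.
pose g (z : E1 * E2 * E2) := ((a z - b z.1) ^+ 2)%R.
have mg : measurable_fun setT g.
  apply: measurable_funX; apply: measurable_funB => //.
  exact: measurableT_comp.
have S1 : g \o pair_rv (pair_rv X V) V' \in Lfun P 1.
  exact/(Lfun2_sqr P (Lfun_measurable S2)).
have [_ gE] := same_law_Lfun1 swapV mg S1.
apply: etrans gE _; congr expectation; apply/funext => w.
by rewrite /g /= /A a_sym.
Qed.

(* The parallelogram identity for A - B and A - C, whose half sum is M and
   whose squares have equal expectations. *)
Lemma antithetic_variance :
  'V_P[S] - 'V_P[M] = 2^-1%:E * 'E_P[fun w => ((B w - Z w) ^+ 2)%R].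
Proof.
have AC2 : (fun w => A w - C w)%R \in Lfun P 2%:E by exact: (Lfun2B A2 C2).
have BC2 : (fun w => B w - C w)%R \in Lfun P 2%:E by exact: (Lfun2B B2 C2).
have sqr1 f : f \in Lfun P 2%:E -> (fun w => f w ^+ 2)%R \in Lfun P 1.
  by move=> f2; exact/(Lfun2_sqr P (Lfun_measurable f2)).
have par : 'E_P[fun w => (S w ^+ 2)%R] + 'E_P[fun w => ((A w - C w) ^+ 2)%R] =
    2%:E * 'E_P[fun w => (M w ^+ 2)%R] +
    2^-1%:E * 'E_P[fun w => ((B w - C w) ^+ 2)%R].
  rewrite -!expectationZl ?sqr1// -!expectationD ?sqr1//; last 2 first.
  - by apply: Lfun_scale => //; exact: sqr1.
  - by apply: Lfun_scale => //; exact: sqr1.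
  by congr expectation; apply/funext => w; rewrite /S /M /=; field.
have [Z2 _] := Z2_ECB.
have BZ2 : (fun w => B w - Z w)%R \in Lfun P 2%:E by exact: (Lfun2B B2 Z2).
(* The parallelogram identity now reads 2 E[S^2] = 2 E[M^2] + E[(B - Z)^2]. All terms are finite, so
   the claim reduces to linear arithmetic over the reals. *)
move: par; rewrite !varianceE// EMS -ESS EBC.
rewrite (_ : S ^+ 2 = fun w => S w ^+ 2)%R// (_ : M ^+ 2 = fun w => M w ^+ 2)%R//.
have /fineK <- := expectation_fin_num (sqr1 _ S2).
have /fineK <- := expectation_fin_num (sqr1 _ M2).
have /fineK <- := expectation_fin_num (sqr1 _ BZ2).
have /fineK <- := expectation_fin_num (Lfun_subset12 Pfin S2).
rewrite -!EFin_expe -!EFinM -!EFinD => -[par]; congr EFin.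
move: par; lra.
Qed.

Lemma Lfun2_slice : Z \in Lfun P 2%:E.
Proof. exact: (proj1 Z2_ECB). Qed.

End antithetic.

(** * The residual Y - E[Y | X] and the conditional variance *)

Section conditional_variance.
Set Implicit Arguments.
Unset Strict Implicit.
Context {d0 : measure_display} {T : measurableType d0} {R : realType}
  (P : probability T R).
Context {d1 : measure_display} {E : measurableType d1} (X : {RV P >-> E}).
Variables (Y : T -> R) (h : E -> R).
Hypotheses (Y2 : Y \in Lfun P 2%:E) (mh : measurable_fun setT h)
  (hY : is_cond_expectation X Y (h \o X)) (h2 : h \o X \in Lfun P 2%:E).

Let D w := (Y w - cond_expectation X Y w)%R.

Let Y1 : Y \in Lfun P 1.
Proof. by apply: Lfun_subset12 Y2; exact: fin_num_measure. Qed.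

Let ceY := cond_expectationP X Y1.

Let mce : measurable_fun setT (cond_expectation X Y).
Proof. by case: ceY => _ ce1 _; exact: Lfun_measurable ce1. Qed.

Let ce_h : {ae P, forall w, h (X w) = cond_expectation X Y w}.
Proof. exact: cond_expectation_unique hY ceY. Qed.

(** The chosen version of E[Y | X] comes with integrability only; square integrability is inherited
    from [h \o X], to which it is almost surely equal. *)
Let D2_sqr : D \in Lfun P 2%:E /\
  'E_P[fun w => ((Y w - h (X w)) ^+ 2)%R] = 'E_P[fun w => (D w ^+ 2)%R].
Proof.
apply: Lfun2_ae_eq (Lfun2B Y2 h2) _ _.
  by apply: measurable_funB => //; exact: Lfun_measurable Y2.
by apply: filterS ce_h => w /= ->.
Qed.

Lemma Lfun2_residual : D \in Lfun P 2%:E.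
Proof. by case: D2_sqr. Qed.

Lemma expectation_sqr_residual :
  'E_P[fun w => ((Y w - h (X w)) ^+ 2)%R] = 'E_P[fun w => (D w ^+ 2)%R].
Proof. by case: D2_sqr. Qed.

(** The defining equation of the conditional expectation of [D ^+ 2], tested on the whole space. *)
Lemma expectation_cond_variance :
  'E_P[cond_variance X Y] = 'E_P[fun w => (D w ^+ 2)%R].
Proof.
have D1 : (fun w => D w ^+ 2)%R \in Lfun P 1.
  exact/(Lfun2_sqr P (Lfun_measurable Lfun2_residual))/Lfun2_residual.
have [_ _] := cond_expectationP X D1.
move=> /(_ setT); rewrite expectation.unlock; apply.
by exists setT; rewrite ?preimage_setT ?setTI.
Qed.

(** A vanishing second moment means Y = E[Y | X] = h(X) almost surely. Conversely, if Y = g(X)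
    almost surely, then [g \o X] is itself a version of E[Y | X], and uniqueness makes the residual
    vanish. *)
Lemma as_function_of_residual0 :
  'E_P[fun w => (D w ^+ 2)%R] = 0 <-> as_function_of X Y.
Proof.
apply: iff_trans (expectation_sqr_eq0 Lfun2_residual) _; split=> [D0|[g mg Yg]].
  exists h => //; apply: filterS2 D0 ce_h => w /eqP.
  by rewrite subr_eq0 => /eqP -> ->.
have mgX : measurable_fun setT (g \o X) by exact: measurableT_comp.
have [gX1 _] := Lfun1_ae_eq Y1 mgX Yg.
have gY : is_cond_expectation X Y (g \o X).
  split=> //.
    move=> B mB; exists (g @^-1` B); last by rewrite setTI.
    by rewrite -[X in measurable X]setTI; exact: mg.
  move=> A XA; have mA := g_sigma_algebra_preimage_measurable XA.
  apply: ae_eq_integral => //.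
  - by apply/measurable_EFinP; exact: measurable_funTS.
  - by apply/measurable_EFinP/measurable_funTS; exact: Lfun_measurable Y2.
  - by apply: filterS Yg => w /= ->.
apply: filterS2 Yg (cond_expectation_unique gY ceY) => w Yw gw.
by rewrite /D Yw -gw subrr.
Qed.

End conditional_variance.

(** * The estimators as functions of [X] and two blocks of [N] samples *)

Section antithetic_level.
Set Implicit Arguments.
Unset Strict Implicit.
Context {d0 : measure_display} {T : measurableType d0} {R : realType}
  (P : probability T R) (d q : nat).
Context (X : {RV P >-> d.-tuple R}) (U_ : nat -> {RV P >-> q.-tuple R}).
Variables (F : d.-tuple R * q.-tuple R -> R) (f : R -> R).
Hypotheses (mF : measurable_fun setT F) (mf : measurable_fun setT f).
Variable N : nat.
Local Open Scope ring_scope.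

Definition block_sum (z : d.-tuple R * N.-tuple (q.-tuple R)) : R :=
  \sum_(i < N) F (z.1, tnth z.2 i).

Definition coarse (z : d.-tuple R * N.-tuple (q.-tuple R)) : R :=
  f (N%:R^-1 * block_sum z).

(** Splitting the sum into two block sums reduces symmetry in the blocks to commutativity of
    addition. *)
Definition fine_level
    (z : d.-tuple R * N.-tuple (q.-tuple R) * N.-tuple (q.-tuple R)) : R :=
  f ((2 * N)%:R^-1 * (block_sum z.1 + block_sum (z.1.1, z.2))).

Lemma measurable_block_sum : measurable_fun setT block_sum.
Proof.
apply: measurable_sum => i; apply: measurableT_comp => //.
apply: measurable_fun_pair => //.
exact: (measurableT_comp (measurable_tnth i) measurable_snd).
Qed.

Lemma measurable_coarse : measurable_fun setT coarse.
Proof.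
apply: measurableT_comp => //; apply: measurable_funM => //.
exact: measurable_block_sum.
Qed.

Lemma measurable_fine_level : measurable_fun setT fine_level.
Proof.
apply: measurableT_comp => //; apply: measurable_funM => //.
apply: measurable_funD.
  by apply: measurableT_comp => //; exact: measurable_block_sum.
apply: (measurableT_comp measurable_block_sum).
by apply: measurable_fun_pair => //; exact: measurableT_comp.
Qed.

Let s (i : 'I_N) : nat := i.
(** With samples numbered from 0, the second block occupies the indices from N to 2N - 1. *)
Let t (i : 'I_N) : nat := (i + N)%N.

Lemma Y_coarse_block w : Y_coarse F f X U_ N w = coarse (X w, block U_ s w).
Proof.
rewrite /Y_coarse /empirical_mean subn0 big_mkord; congr (f (_ * _)).
by apply: eq_bigr => i _ /=; rewrite /block /tuple_rv tnth_mktuple.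
Qed.

Lemma Y_coarse'_block w : Y_coarse' F f X U_ N w = coarse (X w, block U_ t w).
Proof.
rewrite /Y_coarse' /empirical_mean mul2n -addnn addnK.
rewrite -{2}[N]add0n big_addn addnK big_mkord; congr (f (_ * _)).
by apply: eq_bigr => i _ /=; rewrite /block /tuple_rv tnth_mktuple.
Qed.

Lemma Y_fine_block w :
  Y_fine F f X U_ N w = fine_level (X w, block U_ s w, block U_ t w).
Proof.
rewrite /Y_fine /empirical_mean subn0; congr (f (_ * _)).
rewrite (big_cat_nat _ (n := N))//=; last by rewrite mul2n -addnn leq_addr.
congr (_ + _).
  rewrite big_mkord; apply: eq_bigr => i _ /=.
  by rewrite /block /tuple_rv tnth_mktuple.
rewrite -{1}[N]add0n big_addn mul2n -addnn addnK big_mkord.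
by apply: eq_bigr => i _ /=; rewrite /block /tuple_rv tnth_mktuple.
Qed.

End antithetic_level.

(** * The variance identities and the criterion for strict positivity *)

Theorem theorem1 (d0 : measure_display) (T : measurableType d0) (R : realType)
    (P : probability T R) (d q : nat)
    (X : {RV P >-> d.-tuple R}) (U : {RV P >-> q.-tuple R})
    (U_ : nat -> {RV P >-> q.-tuple R})
    (F : d.-tuple R * q.-tuple R -> R) (f : R -> R) :
  abs_continuous_law X ->
  independent_rvs X U ->
  measurable_fun [set: d.-tuple R * q.-tuple R] F ->
  (fun w => F (X w, U w)) \in Lfun P 2%:E ->
  measurable_fun [set: R] f ->
  (forall n, same_law (U_ n) U) ->
  mutually_independent P (joint_sigma X U_) ->
  (forall N, (1 <= N)%N -> Y_ F f X U_ N \in Lfun P 2%:E) ->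
  forall N, (1 <= N)%N ->
  let YN := Y_ F f X U_ N in
  let VS := 'V_P[standard_level F f X U_ N] in
  let VA := 'V_P[antithetic_level F f X U_ N] in
  [/\ VA = VS - 2^-1%:E * 'E_P[cond_variance X YN],
      VS - VA =
        2^-1%:E *
        'N[P]_2%:E[EFin \o (fun w => (YN w - cond_expectation X YN w)%R)] ^+ 2,
      VS - VA = 2^-1%:E * 'E_P[cond_variance X YN],
      0 <= VS - VA
    & 0 < VS - VA <-> ~ as_function_of X YN].
Proof.
move=> _ _ mF _ mf U_U indXU Y2 N N1 YN VS VA.
pose s (i : 'I_N) : nat := i.
pose t (i : 'I_N) : nat := (i + N)%N.
have s_inj : injective s by exact: val_inj.
have t_inj : injective t by move=> i j /addIn/val_inj.
have st i j : s i <> t j.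
  by move=> ij; have := ltn_ord i; rewrite -/(s i) ij /t ltnNge leq_addl.
have ts i j : t i <> s j by move/esym/st.
pose b := coarse F f (N := N).
pose a := fine_level F f (N := N).
have YNE : YN = fun w => b (X w, block U_ s w).
  by apply/funext => w; exact: Y_coarse_block.
have B2 : (fun w => b (X w, block U_ s w)) \in Lfun P 2%:E.
  by rewrite -YNE; exact: Y2.
(* The fine estimator is [Y_] at [2 * N], so the hypothesis on [Y_] at that index applies. *)
have A2 : (fun w => a (X w, block U_ s w, block U_ t w)) \in Lfun P 2%:E.
  rewrite (_ : (fun w => _) = Y_ F f X U_ (2 * N)).
    by apply: Y2; rewrite muln_gt0.
  by apply/funext => w; apply/esym; exact: Y_fine_block.
have mb : measurable_fun setT b by exact: measurable_coarse.
have ma : measurable_fun setT a by exact: measurable_fine_level.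
have a_sym x v v' : a (x, v, v') = a (x, v', v).
  by rewrite /a /fine_level /= addrC.
have lawXV := law_pair_block U_U indXU s_inj t_inj st.
(* The blocks are taken in the opposite order: the first block is independent of [X] together with
   the second block. *)
have lawXVV := law_two_blocks U_U indXU t_inj s_inj ts.
have swapV := law_swap_blocks U_U indXU s_inj t_inj st.
have B1 : (fun w => b (X w, block U_ s w)) \in Lfun P 1.
  by apply: Lfun_subset12 B2; exact: fin_num_measure.
have mh := measurable_slice lawXV mb B1.
have YNh := cond_expectation_slice lawXV mb B1.
have h2 := Lfun2_slice lawXV lawXVV swapV mb B2.
have YN2 := Y2 N N1; rewrite -/YN in YN2.
have YNh' : is_cond_expectation X YN (slice (block U_ s) b \o X).
  by rewrite YNE; exact: YNh.
have VSE : VS = 'V_P[fun w =>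
    (a (X w, block U_ s w, block U_ t w) - b (X w, block U_ s w))%R].
  congr variance; apply/funext => w.
  by rewrite /standard_level Y_fine_block Y_coarse_block.
have VAE : VA = 'V_P[fun w => (a (X w, block U_ s w, block U_ t w) -
    2^-1 * (b (X w, block U_ s w) + b (X w, block U_ t w)))%R].
  congr variance; apply/funext => w.
  by rewrite /antithetic_level Y_fine_block Y_coarse_block Y_coarse'_block.
have D2 := Lfun2_residual YN2 YNh' h2.
have D0 := as_function_of_residual0 YN2 mh YNh' h2.
have DV := expectation_cond_variance YN2 YNh' h2.
have DN := sqr_Lnorm2 D2.
have D1 := expectation_fin_num (proj1 (Lfun2_sqr P (Lfun_measurable D2)) D2).
have De := expectation_sqr_residual YN2 YNh' h2.
have VSA : VS - VA = 2^-1%:E * 'E_P[cond_variance X YN].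
  rewrite DV -De VSE VAE YNE.
  exact: (antithetic_variance lawXV lawXVV swapV ma mb a_sym A2 B2).
have Dge0 : 0 <= 'E_P[cond_variance X YN].
  by rewrite DV; apply: expectation_ge0 => w; exact: sqr_ge0.
have VSA0 : 0 <= VS - VA by rewrite VSA mule_ge0// lee_fin invr_ge0.
have S2 : standard_level F f X U_ N \in Lfun P 2%:E.
  by apply: Lfun2B => //; apply: Y2; rewrite muln_gt0.
(* Solving for [VA] in the extended reals calls for finite variances; finiteness of [VA] is read off
   from that of [VS - VA]. *)
have VSfin : VS \is a fin_num := variance_fin_num S2.
have VAfin : VA \is a fin_num.
  have : VS - VA \is a fin_num by rewrite VSA DV fin_numM.
  by rewrite fin_numB => /andP[].
split => //.
- by rewrite -VSA fin_num_oppeB// addeA subee// add0e.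
- by rewrite DN -DV.
(* The difference is nonnegative, so it is positive exactly when it is nonzero, that is when the
   residual has nonzero second moment. *)
- rewrite lt_neqAle VSA0 andbT -D0 -DV VSA.
  split=> [/eqP + Z0|Z0]; first by rewrite Z0 mule0.
  apply/eqP => /esym/eqP; rewrite mule_eq0 => /orP[|/eqP//].
  by rewrite eqe invr_eq0 pnatr_eq0.
Qed.
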